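(* Let $\mathcal{L} \in \{ \mathbf{IEL}^{-}_{-}, \mathbf{IEL}^{-}, \mathbf{IEL} \}$. Then the intuitionistic modal predicate logic $\mathbf{Q}\mathcal{L}$ is sound and complete with respect to its cover systems. That is, for every formula $\varphi$: $\mathbf{Q}\mathcal{L} \vdash \varphi$ if and only if $\varphi$ is true in every $\mathbf{Q}\mathcal{L}$-cover model, where the $\mathbf{QIEL}^{-}_{-}$-cover models are the models on prenuclear cover systems, the $\mathbf{QIEL}^{-}$-cover models are the models on multiplicative prenuclear cover systems, and the $\mathbf{QIEL}$-cover models are the models on $\mathbf{IEL}$-cover systems.
   Context: Language: countably many individual variables $x_0, x_1, \dots$, predicate symbols of arbitrary arities, no function symbols and no individual constants (so terms are variables); connectives $\bot, \land, \lor, \to, \forall, \exists$ and a unary modality $\bigcirc$; $\neg\varphi$ is $\varphi \to \bot$. Logics. $\mathbf{IEL}^{-}_{-}$ is the least set of propositional modal formulas containing all theorems of intuitionistic propositional logic and all formulas $\varphi \to \bigcirc\varphi$ and $\varphi \land \bigcirc\psi \to \bigcirc(\varphi \land \psi)$, closed under Modus Ponens, Substitution, and $\bigcirc$-monotonicity (from $\varphi \to \psi$ infer $\bigcirc\varphi \to \bigcirc\psi$). $\mathbf{QIEL}^{-}_{-}$ is the predicate logic with axioms: all instances (by predicate modal formulas) of $\mathbf{IEL}^{-}_{-}$; $\forall x \varphi \to \varphi(t/x)$; $\varphi(t/x) \to \exists x \varphi$ ($t$ free for $x$ in $\varphi$); and rules: Modus Ponens, the Bernays rules (from $\varphi\to\psi$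 infer $\varphi\to\forall x\psi$ if $x$ is not free in $\varphi$; from $\varphi\to\psi$ infer $\exists x\varphi\to\psi$ if $x$ is not free in $\psi$), and $\bigcirc$-monotonicity. $\mathbf{QIEL}^{-}$ is obtained from $\mathbf{QIEL}^{-}_{-}$ by adding the axiom scheme $\bigcirc(\varphi \to \psi) \to (\bigcirc\varphi \to \bigcirc\psi)$, and $\mathbf{QIEL}$ is obtained from $\mathbf{QIEL}^{-}$ by adding the axiom $\neg\bigcirc\bot$. Cover systems. For a poset $\langle S, \leq\rangle$ and $A \subseteq S$, ${\uparrow A} = \{x \mid \exists y \in A\ y \leq x\}$, ${\uparrow x} = {\uparrow\{x\}}$; $A$ is an up-set if ${\uparrow A} = A$. A cover system is a triple $\langle S, \leq, \triangleright\rangle$ with $\langle S,\leq\rangle$ a poset and $\triangleright$ a relation between $S$ and $\mathcal{P}(S)$ (if $x \triangleright C$, $C$ is called an $x$-cover) such that for all $x\in S$: (Existence) there is an $x$-cover $C \subseteq {\uparrow x}$; (Transitivity) if $x \triangleright C$ and $y \triangleright C_y$ for each $y \in C$, then $x \triangleright \bigcup_{y\in C} C_y$; (Refinement) if $x \leq y$ and $x \triangleright C$, there is a $y$-cover $C' \subseteq {\uparrow C}$. It is strictly localic if every $x$-cover is included in ${\uparrow x}$, for every $x$. Put $jX = \{x \in S \mid \exists C\ (x \triangleright C \text{ and } C \subseteq X)\}$. A proposition is an up-set $X$ with $jX \subseteq X$; $\operatorname{Prop}$ is the set of all propositions. A modal cover system is $\langle S, \leq, \triangleright, R\rangle$ with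 $\langle S,\leq,\triangleright\rangle$ a strictly localic cover system and $R \subseteq S\times S$, with $R(x) = \{y \mid xRy\}$ and $\langle R\rangle A = \{x \mid \exists y \in A\ xRy\}$, such that: (Confluence) if $x \leq y$ and $xRz$, then there is $w$ with $yRw$ and $z \leq w$; (Modal localisation) if there is $C$ with $x \triangleright C \subseteq \langle R\rangle A$, then there is $y \in R(x)$ with a $y$-cover included in $A$. A modal cover system is prenuclear if (1) $R$ is reflexive and (2) whenever $xRy$ there is $z \in {\uparrow y}$ with $x \leq z$ and $xRz$. It is multiplicative prenuclear if (1) $R$ is serial, i.e. every $x$ has some $y$ with $xRy$; (2) if $xRy$ and $xRz$ then there is $w \in {\uparrow y}\cap{\uparrow z}$ with $xRw$; (3) whenever $xRy$ there is $z \in {\uparrow y}$ with $x \leq z$ and $xRz$. An $\mathbf{IEL}$-cover system is a multiplicative prenuclear cover system such that $xRy$ and $y \triangleright \emptyset$ imply $x \triangleright \emptyset$. Models. A model on a modal cover system $\mathcal{M} = \langle S,\leq,\triangleright,R\rangle$ is $\mathfrak{M} = \langle \mathcal{M}, D, V\rangle$ with $D$ a non-empty set and $V$ assigning to each $k$-ary predicate symbol $P$ a function $V(P): D^k \to \operatorname{Prop}$. A $D$-assignment is a sequence $\sigma = \langle\sigma_0,\sigma_1,\dots\rangle$ in $D$; $\sigma(d/n)$ is $\sigma$ with $\sigma_n$ replaced by $d$. Truth at $x\in S$: - $\mathfrak{M},x,\sigma \Vdash P(x_{n_1},\dots,x_{n_k})$ iff $x \in V(P)(\sigma_{n_1},\dots,\sigma_{n_k})$;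 - $\mathfrak{M},x,\sigma \Vdash \bot$ iff $x \triangleright \emptyset$; - $\mathfrak{M},x,\sigma \Vdash \varphi\land\psi$ iff $\mathfrak{M},x,\sigma \Vdash \varphi$ and $\mathfrak{M},x,\sigma \Vdash \psi$; - $\mathfrak{M},x,\sigma \Vdash \varphi\lor\psi$ iff there is an $x$-cover $C$ such that for each $y\in C$, $\mathfrak{M},y,\sigma \Vdash \varphi$ or $\mathfrak{M},y,\sigma \Vdash \psi$; - $\mathfrak{M},x,\sigma \Vdash \varphi\to\psi$ iff for all $y\in{\uparrow x}$, $\mathfrak{M},y,\sigma \Vdash \varphi$ implies $\mathfrak{M},y,\sigma \Vdash \psi$; - $\mathfrak{M},x,\sigma \Vdash \forall x_n\varphi$ iff $\mathfrak{M},x,\sigma(d/n) \Vdash \varphi$ for each $d\in D$; - $\mathfrak{M},x,\sigma \Vdash \exists x_n\varphi$ iff there is an $x$-cover $C$ such that for each $y\in C$ there is $d\in D$ with $\mathfrak{M},y,\sigma(d/n) \Vdash \varphi$; - $\mathfrak{M},x,\sigma \Vdash \bigcirc\varphi$ iff there is $y\in R(x)$ with $\mathfrak{M},y,\sigma \Vdash \varphi$. A formula $\varphi$ is true in $\mathfrak{M}$ if $\mathfrak{M},x,\sigma \Vdash \varphi$ for all $x \in S$ and all $D$-assignments $\sigma$. *)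

(* Defs.v *)
From mathcomp Require Import all_boot all_order.
From mathcomp Require Import boolp classical_sets.

Set Implicit Arguments.
Unset Strict Implicit.
Unset Printing Implicit Defensive.

Local Open Scope classical_set_scope.
Local Open Scope order_scope.

Inductive iform : Type :=
| IVar of nat
| IBot
| IAnd of iform & iform
| IOr of iform & iform
| IImp of iform & iform.

Inductive ipc : iform -> Prop :=
| ipc_K A B : ipc (IImp A (IImp B A))
| ipc_S A B C :
    ipc (IImp (IImp A (IImp B C)) (IImp (IImp A B) (IImp A C)))
| ipc_andl A B : ipc (IImp (IAnd A B) A)
| ipc_andr A B : ipc (IImp (IAnd A B) B)
| ipc_and A B : ipc (IImp A (IImp B (IAnd A B)))
| ipc_orl A B : ipc (IImp A (IOr A B))
| ipc_orr A B : ipc (IImp B (IOr A B))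
| ipc_or A B C :
    ipc (IImp (IImp A C) (IImp (IImp B C) (IImp (IOr A B) C)))
| ipc_bot A : ipc (IImp IBot A)
| ipc_mp A B : ipc (IImp A B) -> ipc A -> ipc B.

Inductive pform : Type :=
| PVar of nat
| PBot
| PAnd of pform & pform
| POr of pform & pform
| PImp of pform & pform
| PCirc of pform.

Fixpoint pform_of_iform (A : iform) : pform :=
  match A with
  | IVar p => PVar p
  | IBot => PBot
  | IAnd A B => PAnd (pform_of_iform A) (pform_of_iform B)
  | IOr A B => POr (pform_of_iform A) (pform_of_iform B)
  | IImp A B => PImp (pform_of_iform A) (pform_of_iform B)
  end.

Fixpoint psubst (s : nat -> pform) (A : pform) : pform :=
  match A with
  | PVar p => s p
  | PBot => PBot
  | PAnd A B => PAnd (psubst s A) (psubst s B)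
  | POr A B => POr (psubst s A) (psubst s B)
  | PImp A B => PImp (psubst s A) (psubst s B)
  | PCirc A => PCirc (psubst s A)
  end.

(* IEL^-_- (lower and upper minus).  The theorems of intuitionistic logic are
   taken in the circle-free language; their modal instances are obtained by
   Substitution. *)
Inductive ielmm : pform -> Prop :=
| ielmm_ipc A : ipc A -> ielmm (pform_of_iform A)
| ielmm_refl A : ielmm (PImp A (PCirc A))
| ielmm_str A B : ielmm (PImp (PAnd A (PCirc B)) (PCirc (PAnd A B)))
| ielmm_mp A B : ielmm (PImp A B) -> ielmm A -> ielmm B
| ielmm_subst s A : ielmm A -> ielmm (psubst s A)
| ielmm_mono A B : ielmm (PImp A B) -> ielmm (PImp (PCirc A) (PCirc B)).

Record signature := Signature { pred_symb :> Type; arity : pred_symb -> nat }.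

(* IEL^-_-, IEL^- and IEL, respectively. *)
Inductive logic := IELmm | IELm | IEL.

Section Syntax.
Variable Sig : signature.

(* The variable x_n is represented by n. *)
Inductive formula : Type :=
| Atom (P : Sig) of (arity P).-tuple nat
| Bot
| And of formula & formula
| Or of formula & formula
| Imp of formula & formula
| All of nat & formula
| Ex of nat & formula
| Circ of formula.

Definition Neg (phi : formula) : formula := Imp phi Bot.

Fixpoint is_free (x : nat) (phi : formula) : bool :=
  match phi with
  | Atom _ ts => x \in ts
  | Bot => false
  | And phi psi | Or phi psi | Imp phi psi => is_free x phi || is_free x psi
  | All z phi | Ex z phi => (x != z) && is_free x phi
  | Circ phi => is_free x phi
  end.

(* t is free for x in phi: no free occurrence of x lies in the scope of a
   quantifier binding t. *)
Fixpoint free_for (t x : nat) (phi : formula) : bool :=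
  match phi with
  | Atom _ _ | Bot => true
  | And phi psi | Or phi psi | Imp phi psi =>
      free_for t x phi && free_for t x psi
  | All z phi' | Ex z phi' =>
      ~~ is_free x phi || ((t != z) && free_for t x phi')
  | Circ phi => free_for t x phi
  end.

(* phi(t/x), with no renaming of bound variables: only meaningful when t is
   free for x in phi. *)
Fixpoint subst (t x : nat) (phi : formula) : formula :=
  match phi with
  | Atom P ts => Atom (map_tuple (fun y => if y == x then t else y) ts)
  | Bot => Bot
  | And phi psi => And (subst t x phi) (subst t x psi)
  | Or phi psi => Or (subst t x phi) (subst t x psi)
  | Imp phi psi => Imp (subst t x phi) (subst t x psi)
  | All z phi' => if z == x then phi else All z (subst t x phi')
  | Ex z phi' => if z == x then phi else Ex z (subst t x phi')
  | Circ phi => Circ (subst t x phi)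
  end.

Fixpoint inst (s : nat -> formula) (A : pform) : formula :=
  match A with
  | PVar p => s p
  | PBot => Bot
  | PAnd A B => And (inst s A) (inst s B)
  | POr A B => Or (inst s A) (inst s B)
  | PImp A B => Imp (inst s A) (inst s B)
  | PCirc A => Circ (inst s A)
  end.

(* QIEL^-_- extended with the set Ax of additional axioms. *)
Inductive derivable (Ax : set formula) : formula -> Prop :=
| der_inst s A : ielmm A -> derivable Ax (inst s A)
| der_extra phi : Ax phi -> derivable Ax phi
| der_all x t phi :
    free_for t x phi -> derivable Ax (Imp (All x phi) (subst t x phi))
| der_ex x t phi :
    free_for t x phi -> derivable Ax (Imp (subst t x phi) (Ex x phi))
| der_mp phi psi :
    derivable Ax (Imp phi psi) -> derivable Ax phi -> derivable Ax psi
| der_bernays_all x phi psi :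
    ~~ is_free x phi ->
    derivable Ax (Imp phi psi) -> derivable Ax (Imp phi (All x psi))
| der_bernays_ex x phi psi :
    ~~ is_free x psi ->
    derivable Ax (Imp phi psi) -> derivable Ax (Imp (Ex x phi) psi)
| der_mono phi psi :
    derivable Ax (Imp phi psi) -> derivable Ax (Imp (Circ phi) (Circ psi)).

Definition axioms_K : set formula :=
  [set chi | exists phi psi,
     chi = Imp (Circ (Imp phi psi)) (Imp (Circ phi) (Circ psi))].

Definition extra_axioms (L : logic) : set formula :=
  match L with
  | IELmm => set0
  | IELm => axioms_K
  | IEL => axioms_K `|` [set Neg (Circ Bot)]
  end.

Definition Qprovable (L : logic) : formula -> Prop :=
  derivable (extra_axioms L).

End Syntax.

Arguments Bot {Sig}.

Definition up d (S : porderType d) (A : set S) : set S :=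
  [set x | exists2 y, A y & y <= x].

Definition upset d (S : porderType d) (A : set S) : Prop := up A = A.

(* cover x C is x |> C: C is an x-cover. *)
Record cover_system := CoverSystem {
  cs_disp : Order.disp_t;
  cs_sort :> porderType cs_disp;
  cover : cs_sort -> set cs_sort -> Prop;
  cover_existence : forall x, exists2 C, cover x C & C `<=` up [set x];
  cover_transitivity : forall x C (F : cs_sort -> set cs_sort),
    cover x C -> (forall y, C y -> cover y (F y)) ->
    cover x (\bigcup_(y in C) F y);
  cover_refinement : forall x y C,
    x <= y -> cover x C -> exists2 C', cover y C' & C' `<=` up C }.

Definition strictly_localic (S : cover_system) : Prop :=
  forall (x : S) C, cover x C -> C `<=` up [set x].

Definition jop (S : cover_system) (X : set S) : set S :=
  [set x | exists2 C, cover x C & C `<=` X].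

Definition proposition (S : cover_system) (X : set S) : Prop :=
  upset X /\ jop X `<=` X.

(* <R>A *)
Definition dia T (R : T -> T -> Prop) (A : set T) : set T :=
  [set x | exists2 y, A y & R x y].

Record modal_cover_system := ModalCoverSystem {
  mcs_cover_system :> cover_system;
  mcs_localic : strictly_localic mcs_cover_system;
  mrel : mcs_cover_system -> mcs_cover_system -> Prop;
  mcs_confluence : forall x y z,
    x <= y -> mrel x z -> exists2 w, mrel y w & z <= w;
  mcs_modal_localisation : forall x (A : set mcs_cover_system),
    (exists2 C, cover x C & C `<=` dia mrel A) ->
    exists2 y, mrel x y & exists2 C', cover y C' & C' `<=` A }.

Section Classes.
Variable M : modal_cover_system.
Implicit Types x y z w : M.

Definition prenuclear : Prop :=
  (forall x, mrel x x) /\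
  (forall x y, mrel x y -> exists z, [/\ y <= z, x <= z & mrel x z]).

Definition multiplicative_prenuclear : Prop :=
  [/\ (forall x, exists y, mrel x y),
      (forall x y z, mrel x y -> mrel x z ->
         exists w, [/\ y <= w, z <= w & mrel x w]) &
      (forall x y, mrel x y -> exists z, [/\ y <= z, x <= z & mrel x z])].

Definition iel_cover_system : Prop :=
  multiplicative_prenuclear /\
  (forall x y, mrel x y -> cover y set0 -> cover x set0).

End Classes.

Definition cover_system_for (L : logic) (M : modal_cover_system) : Prop :=
  match L with
  | IELmm => prenuclear M
  | IELm => multiplicative_prenuclear M
  | IEL => iel_cover_system M
  end.

Record model (Sig : signature) (M : modal_cover_system) := Model {
  domain : Type;
  domain_inh : inhabited domain;
  valuation : forall P : Sig, (arity P).-tuple domain -> set M;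
  valuation_prop : forall P ds, proposition (@valuation P ds) }.

Section Truth.
Variables (Sig : signature) (M : modal_cover_system) (N : model Sig M).

Fixpoint truth (phi : formula Sig) (x : M) (sigma : nat -> domain N) : Prop :=
  match phi with
  | Atom P ts => valuation (map_tuple sigma ts) x
  | Bot => cover x set0
  | And phi psi => truth phi x sigma /\ truth psi x sigma
  | Or phi psi =>
      exists2 C, cover x C &
        forall y, C y -> truth phi y sigma \/ truth psi y sigma
  | Imp phi psi => forall y, x <= y -> truth phi y sigma -> truth psi y sigma
  | All n phi => forall d, truth phi x [eta sigma with n |-> d]
  | Ex n phi =>
      exists2 C, cover x C &
        forall y, C y -> exists d, truth phi y [eta sigma with n |-> d]
  | Circ phi => exists2 y, mrel x y & truth phi y sigma
  end.

Definition true_in_model (phi : formula Sig) : Prop :=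
  forall x sigma, truth phi x sigma.

End Truth.

(* Main.v *)
(* Soundness rests on the truth sets of formulas being propositions: truth is
   persistent, and it is inherited by a point from any of its covers.

   For completeness, the canonical cover system has as points the elements of
   the MacNeille completion of the Lindenbaum algebra, realised as ideals and
   ordered by reverse inclusion.  A cover of x is a family with join x, and
   x R y means that x is below the join of the Circ c for c in y.  A point
   forces a formula exactly when all elements of the ideal entail it; the
   quantifiers are meets and joins of instances that the completion preserves,
   and the completion provides the joins required by modal localisation. *)

From HB Require Import structures.
From mathcomp Require Import all_boot all_order zify.
From mathcomp Require Import boolp classical_sets.
Require Import Defs.

Set Implicit Arguments.
Unset Strict Implicit.
Unset Printing Implicit Defensive.

(** * Renaming of variables *)

Lemma subst_nonfree (Sig : signature) t n (phi : formula Sig) :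
  ~~ is_free n phi -> subst t n phi = phi.
Proof.
elim: phi => //= [P ts nts|A IA B IB|A IA B IB|A IA B IB|m A IA|m A IA|A IA];
  rewrite ?negb_or; try by case/andP=> /IA-> /IB->.
- congr Atom; apply: val_inj => /=; rewrite -[RHS]map_id.
  by apply/eq_in_map => k kts; case: eqP => // kn; rewrite -kn kts in nts.
- by rewrite eq_sym; case: eqP => //= _ /IA->.
- by rewrite eq_sym; case: eqP => //= _ /IA->.
- by move=> /IA->.
Qed.

Section Renaming.
Variable Sig : signature.
Implicit Types (A B C : formula Sig) (s : nat -> nat) (k n t x z d : nat).

(** Bound variables keep their names and capture is not prevented: the result is meaningful when [s]
    sends free variables away from bound ones, as the shift by [k] does once all variables of [A]
    are below [k]. *)
Fixpoint rename s A : formula Sig :=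
  match A with
  | Atom P ts => Atom (map_tuple s ts)
  | Bot => Bot
  | And A B => And (rename s A) (rename s B)
  | Or A B => Or (rename s A) (rename s B)
  | Imp A B => Imp (rename s A) (rename s B)
  | All z A => All z (rename [eta s with z |-> z] A)
  | Ex z A => Ex z (rename [eta s with z |-> z] A)
  | Circ A => Circ (rename s A)
  end.

(** Binders are counted too, even vacuous ones, so a variable at or above the bound is never
    captured in [A]. *)
Fixpoint var_bound A : nat :=
  match A with
  | Atom _ ts => \max_(n <- ts) n.+1
  | Bot => 0
  | And A B | Or A B | Imp A B => maxn (var_bound A) (var_bound B)
  | All z A | Ex z A => maxn z.+1 (var_bound A)
  | Circ A => var_bound A
  end.

Lemma is_free_lt n A : is_free n A -> n < var_bound A.
Proof.
elim: A => //= [P ts nts|A IA B IB|A IA B IB|A IA B IB|z A IA|z A IA];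
  rewrite ?leq_max; try by case/orP=> [/IA->|/IB->]; rewrite ?orbT.
- by apply: (leq_bigmax_seq _ nts).
- by case/andP=> _ /IA->; rewrite orbT.
- by case/andP=> _ /IA->; rewrite orbT.
Qed.

Lemma eq_rename s s' A :
  (forall n, is_free n A -> s n = s' n) -> rename s A = rename s' A.
Proof.
elim: A s s' => //= [P ts|A IA B IB|A IA B IB|A IA B IB|z A IA|z A IA|A IA] s s' ss'.
- by congr Atom; apply: val_inj; apply/eq_in_map.
- by congr And; [apply: IA|apply: IB] => n An; apply: ss'; rewrite An ?orbT.
- by congr Or; [apply: IA|apply: IB] => n An; apply: ss'; rewrite An ?orbT.
- by congr Imp; [apply: IA|apply: IB] => n An; apply: ss'; rewrite An ?orbT.
- congr All; apply: IA => n An /=.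
  by have [//|nz] := eqVneq n z; apply: ss'; rewrite nz.
- congr Ex; apply: IA => n An /=.
  by have [//|nz] := eqVneq n z; apply: ss'; rewrite nz.
- by congr Circ; apply: IA.
Qed.

Lemma rename_id s A : (forall n, is_free n A -> s n = n) -> rename s A = A.
Proof.
elim: A s => //= [P ts|A IA B IB|A IA B IB|A IA B IB|z A IA|z A IA|A IA] s ss'.
- by congr Atom; apply: val_inj => /=; rewrite -[RHS]map_id; apply/eq_in_map.
- by congr And; [apply: IA|apply: IB] => n An; apply: ss'; rewrite An ?orbT.
- by congr Or; [apply: IA|apply: IB] => n An; apply: ss'; rewrite An ?orbT.
- by congr Imp; [apply: IA|apply: IB] => n An; apply: ss'; rewrite An ?orbT.
- congr All; apply: IA => n An /=.
  by have [//|nz] := eqVneq n z; apply: ss'; rewrite nz.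
- congr Ex; apply: IA => n An /=.
  by have [//|nz] := eqVneq n z; apply: ss'; rewrite nz.
- by congr Circ; apply: IA.
Qed.

Lemma is_free_rename x s A :
  is_free x (rename s A) -> exists2 n, is_free n A & s n = x.
Proof.
have upd r z B : (is_free x (rename [eta r with z |-> z] B) ->
      exists2 n, is_free n B & [eta r with z |-> z] n = x) ->
    (x != z) && is_free x (rename [eta r with z |-> z] B) ->
    exists2 n, (n != z) && is_free n B & r n = x.
  move=> IB /andP[xz /IB[n Bn /=]]; have [nz zx|nz snx] := eqVneq n z.
    by rewrite zx eqxx in xz.
  by exists n => //; rewrite nz.
elim: A s => //= [P ts|A IA B IB|A IA B IB|A IA B IB|z A IA|z A IA] s;
  try by case/orP=> [/IA|/IB] [n An <-]; exists n; rewrite // An ?orbT.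
- by case/mapP=> n nts ->; exists n.
- exact: (upd s z A (IA _)).
- exact: (upd s z A (IA _)).
Qed.

(** A free occurrence of [x] after renaming comes from a free occurrence of some [n] with [s n = x].
    If [n] is [t], that occurrence is under no quantifier on [t]; if [k <= t], no quantifier of the
    formula binds [t]. *)
Lemma free_for_rename k t x s A : var_bound A <= k ->
    (forall n, is_free n A -> s n = x -> (n == t) || (k <= t)) ->
  free_for t x (rename s A).
Proof.
have upd r z B : z < k ->
    (forall n, (n != z) && is_free n B -> r n = x -> (n == t) || (k <= t)) ->
    ((forall n, is_free n B -> [eta r with z |-> z] n = x -> (n == t) || (k <= t)) ->
      free_for t x (rename [eta r with z |-> z] B)) ->
    ~~ ((x != z) && is_free x (rename [eta r with z |-> z] B)) ||
    (t != z) && free_for t x (rename [eta r with z |-> z] B).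
  move=> zk rB IB; case: (boolP (_ && _)) => //= /andP[xz].
  move=> /is_free_rename[n Bn snx]; rewrite IB ?andbT => [|m Bm /=].
    move: snx => /=; have [_ zx|nz rnx] := eqVneq n z.
      by rewrite zx eqxx in xz.
    have := rB n; rewrite nz Bn => /(_ isT rnx) /orP[/eqP<- //|kt].
    by rewrite neq_ltn (leq_trans zk kt) orbT.
  by have [_ zx|mz rmx] := eqVneq m z; [rewrite zx eqxx in xz|apply: rB; rewrite ?mz].
elim: A s => //= [A IA B IB|A IA B IB|A IA B IB|z A IA|z A IA] s;
  rewrite ?geq_max => bk sA; try case/andP: bk => Ak Bk.
- by rewrite IA ?IB // => n An; apply: sA; rewrite An ?orbT.
- by rewrite IA ?IB // => n An; apply: sA; rewrite An ?orbT.
- by rewrite IA ?IB // => n An; apply: sA; rewrite An ?orbT.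
- by apply: upd => //; apply: IA.
- by apply: upd => //; apply: IA.
Qed.

(** [subst] stops at a quantifier on [x], whereas [rename] continues below it. The condition on the
    preimages of [x] makes this harmless: such an [x] is below [k], so only [x] itself could be sent
    to [x], and it is bound there. *)
Lemma subst_rename k t x s s' A : var_bound A <= k ->
    (forall n, is_free n A -> s n = x -> (n == x) || (k <= x)) ->
    (forall n, is_free n A -> s' n = if s n == x then t else s n) ->
  subst t x (rename s A) = rename s' A.
Proof.
have upd r r' z B : z < k ->
    (forall n, (n != z) && is_free n B -> r n = x -> (n == x) || (k <= x)) ->
    (forall n, (n != z) && is_free n B -> r' n = if r n == x then t else r n) ->
    ((forall n, is_free n B -> [eta r with z |-> z] n = x -> (n == x) || (k <= x)) ->
     (forall n, is_free n B -> [eta r' with z |-> z] n =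
        if [eta r with z |-> z] n == x then t else [eta r with z |-> z] n) ->
      subst t x (rename [eta r with z |-> z] B) = rename [eta r' with z |-> z] B) ->
    (if z == x then rename [eta r with z |-> z] B
     else subst t x (rename [eta r with z |-> z] B)) = rename [eta r' with z |-> z] B.
  move=> zk rB r'B IB; case: (eqVneq z x) => [zx|zx].
    apply: eq_rename => n Bn /=; have [//|nz] := eqVneq n z.
    rewrite r'B ?nz //; case: eqP => // rnx.
    have := rB n; rewrite nz Bn => /(_ isT rnx).
    by rewrite -zx (negPf nz) leqNgt zk.
  apply: IB => n Bn /=; have [_|nz] := eqVneq n z; rewrite ?(negPf zx) //.
  - by move=> zx'; rewrite zx' eqxx in zx.
  - by apply: rB; rewrite nz.
  - by apply: r'B; rewrite nz.
elim: A s s' => //= [P ts|A IA B IB|A IA B IB|A IA B IB|z A IA|z A IA|A IA] s s';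
  rewrite ?geq_max => bk sA s'A; try case/andP: bk => Ak Bk.
- congr Atom; apply: val_inj; rewrite /= -map_comp.
  by apply/eq_in_map => n nts; rewrite /= s'A.
- by congr And; [apply: IA|apply: IB] => // n An;
    (apply: sA||apply: s'A); rewrite An ?orbT.
- by congr Or; [apply: IA|apply: IB] => // n An;
    (apply: sA||apply: s'A); rewrite An ?orbT.
- by congr Imp; [apply: IA|apply: IB] => // n An;
    (apply: sA||apply: s'A); rewrite An ?orbT.
- rewrite -(upd s s' z A) // => [|sA' s'A']; first by case: (z == x).
  exact: IA.
- rewrite -(upd s s' z A) // => [|sA' s'A']; first by case: (z == x).
  exact: IA.
- by congr Circ; apply: IA.
Qed.

End Renaming.

(** * Derivability *)

Local Open Scope classical_set_scope.

Section Entailment.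
Variables (Sig : signature) (Ax : set (formula Sig)).
Implicit Types A B C D : formula Sig.

(** The preorder whose quotient is the Lindenbaum algebra. *)
Definition entails A B := derivable Ax (Imp A B).

(** The propositional letters 0, 1, 2 are read as [A], [B], [C], so that instances of propositional
    axioms become the wanted formulas by computation. *)
Let v A B C := nth (@Bot Sig) [:: A; B; C].
Let p := IVar 0.
Let q := IVar 1.
Let r := IVar 2.

Lemma derivable_entails A B : derivable Ax B -> entails A B.
Proof. exact/der_mp/(der_inst Ax (v B A A) (ielmm_ipc (ipc_K p q))). Qed.

Lemma entails_mp C A B : entails C (Imp A B) -> entails C A -> entails C B.
Proof.
by move=> H; apply/der_mp/(der_mp (der_inst Ax (v C A B) (ielmm_ipc (ipc_S p q r)))).
Qed.

Lemma entails_trans A B C : entails A B -> entails B C -> entails A C.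
Proof. by move=> AB /derivable_entails BC; apply: entails_mp AB. Qed.

Lemma entails_refl A : entails A A.
Proof.
have K B := der_inst Ax (v A B A) (ielmm_ipc (ipc_K p q)).
exact: entails_mp (K (Imp A A)) (K A).
Qed.

Lemma entails_andl A B : entails (And A B) A.
Proof. exact: (der_inst Ax (v A B A) (ielmm_ipc (ipc_andl p q))). Qed.

Lemma entails_andr A B : entails (And A B) B.
Proof. exact: (der_inst Ax (v A B A) (ielmm_ipc (ipc_andr p q))). Qed.

Lemma entails_and C A B : entails C A -> entails C B -> entails C (And A B).
Proof.
have AB := der_inst Ax (v A B A) (ielmm_ipc (ipc_and p q)).
by move=> CA; apply: entails_mp; apply: entails_trans CA AB.
Qed.

(** Residuation, the source of the distributivity used for canonical covers. *)
Lemma entails_imp C A B : entails C (Imp A B) <-> entails (And C A) B.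
Proof.
split=> H.
  by apply: entails_mp (entails_andr C A); apply: entails_trans H; apply: entails_andl.
have CA := der_inst Ax (v C A A) (ielmm_ipc (ipc_and p q)).
have := der_inst Ax (v A (And C A) B) (ielmm_ipc (ipc_S p q r)).
move=> /der_mp/(_ (derivable_entails A H)); exact: entails_trans.
Qed.

Lemma entails_swap A B C : entails A (Imp B C) -> entails B (Imp A C).
Proof.
move/entails_imp => H; apply/entails_imp/entails_trans/H.
by apply: entails_and; [apply: entails_andr|apply: entails_andl].
Qed.

Lemma entails_orl A B : entails A (Or A B).
Proof. exact: (der_inst Ax (v A B A) (ielmm_ipc (ipc_orl p q))). Qed.

Lemma entails_orr A B : entails B (Or A B).
Proof. exact: (der_inst Ax (v A B A) (ielmm_ipc (ipc_orr p q))). Qed.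

Lemma entails_or A B C : entails A C -> entails B C -> entails (Or A B) C.
Proof.
move=> AC; apply/der_mp.
exact: der_mp (der_inst Ax (v A B C) (ielmm_ipc (ipc_or p q r))) AC.
Qed.

Lemma entails_bot A : entails Bot A.
Proof. exact: (der_inst Ax (v A A A) (ielmm_ipc (ipc_bot p))). Qed.

Lemma entails_circ A : entails A (Circ A).
Proof. exact: (der_inst Ax (v A A A) (ielmm_refl (PVar 0))). Qed.

Lemma entails_circ_and A B : entails (And A (Circ B)) (Circ (And A B)).
Proof. exact: (der_inst Ax (v A B A) (ielmm_str (PVar 0) (PVar 1))). Qed.

(** Monotonicity applied to the theorem that [A] implies [Imp B (And A B)] puts this implication
    under [Circ]; the extra scheme then distributes [Circ] over it. *)
Lemma entails_circ_and2 A B : axioms_K (Sig := Sig) `<=` Ax ->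
  entails (And (Circ A) (Circ B)) (Circ (And A B)).
Proof.
move=> KAx; apply/entails_imp.
have /der_mono := der_inst Ax (v A B A) (ielmm_ipc (ipc_and p q)).
move/entails_trans; apply; apply: der_extra; apply: KAx.
by exists B, (And A B).
Qed.

End Entailment.

(** * Quantifiers as meets and joins of instances *)

Section Quantifiers.
Variables (Sig : signature) (Ax : set (formula Sig)).
Implicit Types (A B C : formula Sig) (s : nat -> nat) (k n t x z d : nat).
Local Notation "A |- B" := (entails Ax A B) (at level 70).

Lemma fresh_variable k s A C : var_bound A <= k ->
  exists d, [/\ k <= d, ~~ is_free d C & forall n, is_free n A -> s n != d].
Proof.
(* The witness exceeds [k], every variable of [C], and [s n] for all [n < k], hence for all free [n]
   of [A]. *)
move=> Ak; exists (k + var_bound C + \max_(n < k) s n).+1; split; first by lia.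
  by apply/negP => /is_free_lt; lia.
move=> n /is_free_lt nA; rewrite neq_ltn; apply/orP; left.
by have := leq_bigmax (F := fun n : 'I_k => s n) (Ordinal (leq_trans nA Ak)) => /=; lia.
Qed.

Section Body.
Variables (k z : nat) (s : nat -> nat) (A : formula Sig).
Hypotheses (zk : z < k) (Ak : var_bound A <= k) (sk : forall n, k <= s n).
(** [All z (body z)] is [All z A] renamed by [s], and [body d] is its instance at [d]. The values of
    [s] start at [k], so they never meet a bound variable. *)
Local Notation body d := (rename [eta s with z |-> d] A).

Lemma subst_body d : subst d z (body z) = body d.
Proof.
apply: (subst_rename Ak) => n An /=; have [|nz] := eqVneq n z; rewrite ?eqxx //.
  by move=> sz; have := sk n; rewrite sz leqNgt zk.
by case: eqP => // sz; have := sk n; rewrite sz leqNgt zk.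
Qed.

Lemma free_for_body d : k <= d -> free_for d z (body z).
Proof. by move=> kd; apply: (free_for_rename Ak) => n _ _; rewrite kd orbT. Qed.

Lemma subst_body_fresh d : k <= d -> (forall n, is_free n A -> s n != d) ->
  subst z d (body d) = body z.
Proof.
move=> kd sd; apply: (subst_rename Ak) => n An /=; first by rewrite kd orbT.
by have [|nz] := eqVneq n z; rewrite ?eqxx // (negPf (sd n An)).
Qed.

Lemma free_for_body_fresh d : (forall n, is_free n A -> s n != d) ->
  free_for z d (body d).
Proof.
move=> sd; apply: (free_for_rename Ak) => n An /=.
by have [//|nz /eqP] := eqVneq n z; rewrite (negPf (sd n An)).
Qed.

Lemma notin_body d : k <= d -> ~~ is_free z (body d).
Proof.
move=> kd; apply/negP => /is_free_rename[n _ /=].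
by case: eqP => [_|_] zE; [|have := sk n]; move: zk; rewrite -zE; lia.
Qed.

(** A universal formula is the meet of its instances at variables from [k] on. For the converse of
    instantiation, the instance at a fresh [d] is generalised by a Bernays rule, and the bound
    variable is then changed from [d] to [z]. *)
Lemma entails_all C :
  (C |- All z (body z)) <-> forall d, k <= d -> C |- body d.
Proof.
split=> [CA d kd|CA].
  by apply: entails_trans CA _; rewrite -(subst_body d); apply/der_all/free_for_body.
have [d [kd Cd sd]] := fresh_variable s C Ak.
apply: (@entails_trans _ _ _ (All d (body d))).
  by apply: der_bernays_all (CA d kd).
apply: der_bernays_all; first by rewrite /= negb_and notin_body // orbT.
by rewrite -(subst_body_fresh kd sd); apply/der_all/free_for_body_fresh.
Qed.

(** The dual argument: an existential formula is the join of these instances. *)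
Lemma entails_ex C :
  (Ex z (body z) |- C) <-> forall d, k <= d -> body d |- C.
Proof.
split=> [AC d kd|AC].
  by apply: entails_trans AC; rewrite -(subst_body d); apply/der_ex/free_for_body.
have [d [kd Cd sd]] := fresh_variable s C Ak.
apply: (@entails_trans _ _ _ (Ex d (body d))); last first.
  by apply: der_bernays_ex (AC d kd).
apply: der_bernays_ex; first by rewrite /= negb_and notin_body // orbT.
by rewrite -(subst_body_fresh kd sd); apply/der_ex/free_for_body_fresh.
Qed.

End Body.

Lemma derivable_subst t x A :
  free_for t x A -> derivable Ax A -> derivable Ax (subst t x A).
Proof.
(* The Bernays rule acts on implications; this closed theorem serves as antecedent. *)
move=> ff DA; have T : derivable Ax (Imp Bot Bot) by apply: entails_refl.
apply: (der_mp _ T); apply: entails_trans (der_all Ax ff).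
exact/der_bernays_all/derivable_entails.
Qed.

(** The shift is undone one variable at a time: [s j] fixes the variables below [j] and shifts the
    others, and substituting [j] for [k + j] leads from [s j] to [s j.+1]. *)
Lemma derivable_rename_add k A :
  var_bound A <= k -> derivable Ax (rename (addn k) A) -> derivable Ax A.
Proof.
move=> Ak DA; pose s j n := if n < j then n else k + n.
suff Ds j : j <= k -> derivable Ax (rename (s j) A).
  rewrite -[A](@rename_id _ (s k)) => [|n /is_free_lt nA]; first exact: Ds.
  by rewrite /s (leq_trans nA Ak).
elim: j => [_|j IHj jk].
  by suff -> : rename (s 0) A = rename (addn k) A by []; apply: eq_rename.
rewrite -(@subst_rename _ k j (k + j) (s j)) // => [|n An _|n /is_free_lt nA].
- apply: derivable_subst (IHj (ltnW jk)).
  apply: (free_for_rename Ak) => n /is_free_lt nA; rewrite /s; case: ifP; lia.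
- by rewrite leq_addr orbT.
- rewrite /s ltnS leq_eqVlt; have [->|nj] := eqVneq n j; first by rewrite ltnn eqxx.
  by case: ltnP => nj' /=; case: eqP; lia.
Qed.

End Quantifiers.

(** * Soundness *)

Import Order.TTheory.
Local Open Scope order_scope.

Section Truth_theory.
Variables (Sig : signature) (M : modal_cover_system) (N : model Sig M).
Implicit Types (phi psi : formula Sig) (x y z : M) (s : nat -> domain N).

(** Refinement of covers handles [Bot], [Or] and [Ex], confluence handles [Circ], and atoms denote
    up-sets. *)
Lemma truth_up phi x y s : x <= y -> truth phi x s -> truth phi y s.
Proof.
elim: phi x y s => [P ts||A IA B IB|A IA B IB|A IA B IB|n A IA|n A IA|A IA]
  x y s le_xy /=.
- by move=> Vx; case: (valuation_prop (map_tuple s ts)) => <- _; exists x.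
- move=> /(cover_refinement le_xy)[C Cy sC]; suff <- : C = set0 by [].
  by apply/seteqP; split=> // z /sC[].
- by case=> /(IA _ _ _ le_xy) ? /(IB _ _ _ le_xy).
- move=> [C /(cover_refinement le_xy)[C' Cy sC] tC]; exists C' => // z /sC[w].
  by move=> /tC[tw|tw] le_wz; [left; apply: IA tw|right; apply: IB tw].
- by move=> tx z le_yz; apply: tx; apply: le_trans le_yz.
- by move=> tx d; apply: IA (tx d).
- move=> [C /(cover_refinement le_xy)[C' Cy sC] tC]; exists C' => // z /sC[w].
  by move=> /tC[d tw] le_wz; exists d; apply: IA tw.
- move=> [z Rxz tz]; have [w Ryw le_zw] := mcs_confluence le_xy Rxz.
  by exists w => //; apply: IA tz.
Qed.

Lemma cover_glue x (C : set M) (Q : set M -> Prop) :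
    cover x C -> (forall y, C y -> exists2 D, cover y D & Q D) ->
  exists2 F : M -> set M,
    cover x (\bigcup_(y in C) F y) & forall y, C y -> Q (F y).
Proof.
move=> Cx CQ; have [F FP]: {F : M -> set M &
    forall y, C y -> cover y (F y) /\ Q (F y)}.
  apply: (@choice _ _ (fun y D => C y -> cover y D /\ Q D)) => y.
  have [/CQ[D Dy QD]|nCy] := pselect (C y); first by exists D.
  (* Default value off [C], where the union does not look. *)
  by exists set0.
by exists F => [|y /FP[]//]; apply: cover_transitivity => // y /FP[].
Qed.

(** Transitivity glues covers for [Bot], [Or] and [Ex]; modal localisation is exactly what [Circ]
    needs. *)
Lemma truth_local phi x (C : set M) s :
  cover x C -> (forall y, C y -> truth phi y s) -> truth phi x s.
Proof.
elim: phi x C s => [P ts||A IA B IB|A IA B IB|A IA B IB|n A IA|n A IA|A IA]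
  x C s Cx /= tC.
- by case: (valuation_prop (map_tuple s ts)) => _; apply; exists C.
- have := cover_transitivity Cx tC; suff -> : \bigcup_(y in C) set0 = set0 by [].
  by move=> T; apply: bigcup0.
- by split; [apply: IA Cx _|apply: IB Cx _] => y /tC[].
- have [F Fx tF] := cover_glue (Q := fun D => forall y, D y -> _ \/ _) Cx tC.
  by exists (\bigcup_(y in C) F y) => // y [z Cz]; apply: tF.
(* By strict locality the members of the refined cover lie above [y], so the antecedent persists to
   them. *)
- move=> y le_xy tA; have [C' Cy sC] := cover_refinement le_xy Cx.
  apply: (IB y C') => // z C'z; have [w /tC tw le_wz] := sC z C'z.
  apply: tw => //; apply: truth_up tA.
  by have [_ ->] := mcs_localic Cy C'z.
- by move=> d; apply: IA Cx _ => y /tC.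
- have [F Fx tF] := cover_glue (Q := fun D => forall y, D y -> exists d, _) Cx tC.
  by exists (\bigcup_(y in C) F y) => // y [z Cz]; apply: tF.
- have [|y Rxy [C' Cy tC']] := @mcs_modal_localisation M x [set z | truth A z s].
    by exists C => // y /tC[z Ryz tz]; exists z.
  by exists y => //; apply: IA Cy _.
Qed.

Lemma truth_ext phi x s s' :
  (forall n, is_free n phi -> s n = s' n) -> truth phi x s -> truth phi x s'.
Proof.
have upd A n d r r' : (forall m, (m != n) && is_free m A -> r m = r' m) ->
    forall m, is_free m A ->
      [eta r with n |-> d] m = [eta r' with n |-> d] m :> domain N.
  by move=> rr' m Am /=; case: eqP => // /eqP mn; apply: rr'; rewrite mn.
elim: phi x s s' => [P ts||A IA B IB|A IA B IB|A IA B IB|n A IA|n A IA|A IA]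
  x s s' ss' //=.
- suff -> : map_tuple s ts = map_tuple s' ts by [].
  by apply: val_inj; apply/eq_in_map => n; apply: ss'.
- by case=> tA tB; split; [apply: IA tA|apply: IB tB] => n An;
    apply: ss'; rewrite /= An ?orbT.
- case=> C Cx tC; exists C => // y /tC[tA|tB]; [left|right].
    by apply: IA tA => n An; apply: ss'; rewrite /= An.
  by apply: IB tB => n An; apply: ss'; rewrite /= An orbT.
- move=> tAB y le_xy tA; apply: (IB y s) => [n Bn|].
    by apply: ss'; rewrite /= Bn orbT.
  by apply: tAB => //; apply: IA tA => n An; rewrite ss' //= An.
- by move=> tA d; apply: IA (tA d); apply: upd.
- by case=> C Cx tC; exists C => // y /tC[d tA]; exists d; apply: IA tA; apply: upd.
- by case=> y Rxy tA; exists y => //; apply: IA tA.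
Qed.

Lemma truth_subst t n phi x s : free_for t n phi ->
  truth (subst t n phi) x s <-> truth phi x [eta s with n |-> s t].
Proof.
(* The case of both quantifiers: either [n] is not free in [A] and nothing is substituted, or [t]
   differs from the bound [m] and the update at [m] keeps the value of [t]. *)
have body m A : m != n -> ~~ is_free n A || (t != m) && free_for t n A ->
    (forall x' s', free_for t n A ->
       truth (subst t n A) x' s' <-> truth A x' [eta s' with n |-> s' t]) ->
    forall x' s' d, truth (subst t n A) x' [eta s' with m |-> d] <->
      truth A x' [eta [eta s' with n |-> s' t] with m |-> d].
  move=> mn /orP[An _ x' s' d|/andP[tm ff] IA x' s' d].
    rewrite subst_nonfree //; split; apply: truth_ext => k Ak /=;
    by have [kn|//] := eqVneq k n; rewrite -kn Ak in An.
  rewrite IA //; split; apply: truth_ext => k Ak /=; rewrite (negPf tm);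
  by have [->|//] := eqVneq k n; rewrite eq_sym (negPf mn).
elim: phi x s => [P ts||A IA B IB|A IA B IB|A IA B IB|m A IA|m A IA|A IA]
  x s //=.
- move=> _; suff -> : map_tuple s (map_tuple (fun k => if k == n then t else k) ts) =
      map_tuple [eta s with n |-> s t] ts by [].
  by apply: val_inj; rewrite /= -map_comp; apply: eq_map => m /=; case: eqP.
- by case/andP=> /IA tA /IB tB; rewrite tA tB.
- case/andP=> /IA tA /IB tB.
  by split=> -[C Cx tC]; exists C => // y /tC; rewrite tA tB.
- case/andP=> /IA tA /IB tB.
  by split=> tx y le_xy; have := tx y le_xy; rewrite tA tB.
- have [->|mn] := eqVneq m n.
    by move=> _; split=> tx d; apply: truth_ext (tx d) => k _ /=; case: (k == n).
  by move=> /= ff; have tA := body m A mn ff IA; split=> tx d; apply/tA.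
- have [->|mn] := eqVneq m n.
    move=> _; split=> -[C Cx tC]; exists C => // y /tC[d td]; exists d;
    by apply: truth_ext td => k _ /=; case: (k == n).
  move=> /= ff; have tA := body m A mn ff IA.
  by split=> -[C Cx tC]; exists C => // y /tC[d td]; exists d; apply/tA.
- by move=> /IA tA; split=> -[y Rxy ty]; exists y => //; apply/tA.
Qed.

Lemma truth_ipc A (v : nat -> formula Sig) x s :
  ipc A -> truth (inst v (pform_of_iform A)) x s.
Proof.
move=> AP; elim: AP v x => {A}/=.
- by move=> A B v x y _ tA z le_yz _; apply: truth_up tA.
- move=> A B C v x y _ tABC z le_yz tAB w le_zw tA.
  apply: (tABC w _ tA w (lexx w)); first exact: le_trans le_zw.
  exact: tAB.
- by move=> A B v x y _ [].
- by move=> A B v x y _ [].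
- by move=> A B v x y _ tA z le_yz tB; split=> //; apply: truth_up tA.
- move=> A B v x y _ tA; have [C Cy sC] := cover_existence y.
  by exists C => // z /sC[_ ->] /truth_up le_yz; left; apply: le_yz.
- move=> A B v x y _ tB; have [C Cy sC] := cover_existence y.
  by exists C => // z /sC[_ ->] /truth_up le_yz; right; apply: le_yz.
- move=> A B C v x y _ tA z le_yz tB w le_zw [D Dw tD].
  (* Strict locality puts the cover for the disjunction above [w], so both implications apply at its
     members, and the conclusion returns to [w]. *)
  apply: (truth_local Dw) => u Du; have [_ -> le_wu] := mcs_localic Dw Du.
  case: (tD u Du); last by apply: tB; apply: le_trans le_wu.
  by apply: tA; apply: le_trans le_wu; apply: le_trans le_zw.
- move=> A v x y _ Cy; exact: truth_local Cy _.
- by move=> A B _ tAB _ tA v x; apply: tAB (lexx x) (tA v x).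
Qed.

Lemma inst_psubst v (r : nat -> pform) A :
  inst v (psubst r A) = inst (fun p => inst v (r p)) A :> formula Sig.
Proof. by elim: A => //= [A -> B ->|A -> B ->|A -> B ->|A ->]. Qed.

(** The two conditions on [mrel] are common to all three classes of cover systems; the first
    validates [ielmm_refl], the second [ielmm_str]. *)
Lemma truth_ielmm A (v : nat -> formula Sig) x s :
    (forall x, exists2 y, x <= y & mrel x y) ->
    (forall x y, mrel x y -> exists z, [/\ y <= z, x <= z & mrel x z]) ->
  ielmm A -> truth (inst v A) x s.
Proof.
move=> ser str AP; elim: AP v x => {A}/=.
- by move=> A AP v x; apply: truth_ipc.
- by move=> A v x y _ tA; have [z /truth_up le_yz Ryz] := ser y; exists z; auto.
- move=> A B v x y _ [tA [z Ryz tB]]; have [w [le_zw le_yw Ryw]] := str y z Ryz.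
  by exists w => //; split; [apply: truth_up tA|apply: truth_up tB].
- by move=> A B _ tAB _ tA v x; apply: tAB (lexx x) (tA v x).
- by move=> r A _ tA v x; rewrite inst_psubst.
- by move=> A B _ tAB v x y _ [z Ryz tA]; exists z => //; apply: tAB (lexx z) tA.
Qed.

Lemma truth_derivable (Ax : set (formula Sig)) phi :
    (forall x, exists2 y, x <= y & mrel x y) ->
    (forall x y, mrel x y -> exists z, [/\ y <= z, x <= z & mrel x z]) ->
    (forall chi, Ax chi -> true_in_model N chi) ->
  derivable Ax phi -> true_in_model N phi.
Proof.
move=> ser str tAx; elim=> {phi}.
- by move=> v A AP x s; apply: truth_ielmm.
- exact: tAx.
- move=> n t phi ff x s y _ tphi; apply/truth_subst => //; exact: tphi.
- move=> n t phi ff x s y _ /truth_subst-/(_ ff) tphi.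
  have [C Cy sC] := cover_existence y; exists C => // z /sC[_ ->] le_yz.
  by exists (s t); apply: truth_up tphi.
- by move=> phi psi _ tpp _ tphi x s; apply: tpp (lexx x) (tphi x s).
- move=> n phi psi nfr _ tpp x s y _ tphi d /=.
  apply: (tpp y _ y (lexx y)); apply: truth_ext tphi => k fk /=.
  by have [kn|//] := eqVneq k n; rewrite -kn fk in nfr.
- move=> n phi psi nfr _ tpp x s y _ [C Cy tC].
  apply: truth_local Cy _ => z /tC[d tphi].
  have := tpp z _ z (lexx z) tphi; apply: truth_ext => k fk /=.
  by have [kn|//] := eqVneq k n; rewrite -kn fk in nfr.
- by move=> phi psi _ tpp x s y _ [z Ryz tphi]; exists z => //; apply: tpp (lexx z) _.
Qed.

End Truth_theory.

Lemma soundness (Sig : signature) (L : logic) (phi : formula Sig)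
    (M : modal_cover_system) (N : model Sig M) :
  Qprovable L phi -> cover_system_for L M -> true_in_model N phi.
Proof.
move=> Dphi; have mult : multiplicative_prenuclear M ->
    (forall x : M, exists2 y, x <= y & mrel x y) /\
    forall psi, axioms_K psi -> true_in_model N psi.
  case=> ser mul str; split=> [x|_ [A [B ->]] x s y _ /= [z Ryz tAB] w le_yw].
    by have [y /str[z [_ le_xz Rxz]]] := ser x; exists z.
  (* Confluence moves the witness of the boxed implication to a successor of [w], which
     multiplicativity merges with the witness [u] of the boxed antecedent. *)
  case=> u Rwu tA; have [v Rwv le_zv] := mcs_confluence le_yw Ryz.
  have [t [le_vt le_ut Rwt]] := mul w v u Rwv Rwu; exists t => //.
  by apply: tAB; [apply: le_trans le_vt|apply: truth_up tA].
case: L Dphi => Dphi /=.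
- by case=> refl str; apply: truth_derivable Dphi => // x; exists x.
- by move=> /[dup] mM [_ _ str]; have [ser tK] := mult mM; apply: truth_derivable Dphi.
- case=> /[dup] mM [_ _ str] tB; have [ser tK] := mult mM.
  apply: truth_derivable Dphi => // psi [/tK//|-> x s y _ [z]].
  exact: tB.
Qed.

(** * The canonical cover system *)

(* Ideals of the Lindenbaum algebra that contain every lower bound of their
   upper bounds: they form its MacNeille completion. *)
Record ideal (Sig : signature) (Ax : set (formula Sig)) := Ideal {
  ideal_set :> set (formula Sig);
  ideal_closed : forall a,
    (forall b, (forall c, ideal_set c -> entails Ax c b) -> entails Ax a b) ->
    ideal_set a }.

Section Canonical_cover_system.
Variables (Sig : signature) (Ax : set (formula Sig)).
Implicit Types (a b c : formula Sig) (x y z : ideal Ax).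
Local Notation "a |- b" := (entails Ax a b) (at level 70).

HB.instance Definition _ := gen_eqMixin (ideal Ax).
HB.instance Definition _ := gen_choiceMixin (ideal Ax).

Lemma ideal_eq x y : ideal_set x = ideal_set y -> x = y.
Proof.
by case: x y => [X cX] [Y cY] /= XY; subst Y; congr Ideal; apply: Prop_irrelevance.
Qed.

Definition ideal_le x y := `[< y `<=` x >].

Lemma ideal_le_refl : reflexive ideal_le.
Proof. by move=> x; apply/asboolP. Qed.

Lemma ideal_le_anti : antisymmetric ideal_le.
Proof.
by move=> x y /andP[/asboolP yx /asboolP xy]; apply: ideal_eq; apply/seteqP.
Qed.

Lemma ideal_le_trans : transitive ideal_le.
Proof.
by move=> y x z /asboolP yx /asboolP zy; apply/asboolP => a /zy/yx.
Qed.

HB.instance Definition _ := Order.Le_isPOrder.Build (Order.Disp tt tt) (ideal Ax)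
  ideal_le_refl ideal_le_anti ideal_le_trans.

Lemma ideal_leP x y : reflect (y `<=` x) (x <= y).
Proof. exact: asboolP. Qed.

Lemma ideal_down x a b : a |- b -> ideal_set x b -> ideal_set x a.
Proof. by move=> ab xb; apply: ideal_closed => c /(_ b xb); apply: entails_trans. Qed.

Lemma idealI_closed x y a :
  (forall b, (forall c, (x `&` y)%classic c -> c |- b) -> a |- b) ->
  (x `&` y)%classic a.
Proof.
by move=> H; split; apply: ideal_closed => b ub; apply: H => c [xc yc]; apply: ub.
Qed.

(** The meet in the completion; as the order is reversed, the least point above both [x] and [y]. *)
Definition idealI x y := Ideal (@idealI_closed x y).

Lemma principal_closed a b :
  (forall c, (forall d, d |- a -> d |- c) -> b |- c) -> b |- a.
Proof. exact. Qed.

(** The embedding of the Lindenbaum algebra into its completion. *)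
Definition principal a : ideal Ax :=
  @Ideal _ _ [set b | b |- a] (@principal_closed a).

Lemma ideal_closure_closed (X : set (formula Sig)) a :
  (forall b, (forall c, (forall d, (forall e, X e -> e |- d) -> c |- d) ->
     c |- b) -> a |- b) ->
  forall b, (forall e, X e -> e |- b) -> a |- b.
Proof. by move=> H b Xb; apply: H => c; apply. Qed.

(** The join of [X] in the completion. *)
Definition ideal_closure (X : set (formula Sig)) : ideal Ax :=
  @Ideal _ _ [set a | forall b, (forall c, X c -> c |- b) -> a |- b]
    (@ideal_closure_closed X).

Lemma sub_ideal_closure (X : set (formula Sig)) : X `<=` ideal_closure X.
Proof. by move=> a Xa b; apply. Qed.

(** An ideal is determined by the formulas bounding it, so comparing [x] with the join of [C] only
    requires testing these formulas. *)
Definition ideal_cover x (C : set (ideal Ax)) :=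
  (forall y, C y -> y `<=` x) /\
  forall a b, ideal_set x a ->
    (forall y c, C y -> ideal_set y c -> c |- b) -> a |- b.

Lemma ideal_cover_existence x : exists2 C, ideal_cover x C & C `<=` up [set x].
Proof.
exists [set x]; last by move=> _ ->; exists x.
by split=> [_ -> //|a b xa]; apply.
Qed.

Lemma ideal_cover_transitivity x C (F : ideal Ax -> set (ideal Ax)) :
    ideal_cover x C -> (forall y, C y -> ideal_cover y (F y)) ->
  ideal_cover x (\bigcup_(y in C) F y).
Proof.
move=> [Cx xC] CF; split=> [z [y Cy Fyz] a za|a b xa H].
  by apply: (Cx _ Cy); case: (CF y Cy) => Fy _; apply: Fy za.
apply: (xC _ _ xa) => y c Cy yc; case: (CF y Cy) => _ yF.
by apply: (yF _ _ yc) => z d Fz; apply: H; exists y.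
Qed.

(** Distributivity: the meet of [y] with a join is the join of the meets. *)
Lemma ideal_cover_refinement x y C : x <= y -> ideal_cover x C ->
  exists2 C', ideal_cover y C' & C' `<=` up C.
Proof.
move=> /ideal_leP yx [Cx xC]; exists [set idealI y z | z in C]; last first.
  by move=> _ [z Cz <-]; exists z => //; apply/ideal_leP => a [].
split=> [_ [z Cz <-] a []//|a b ya H].
(* It suffices that [a] entails [Imp a b]: this formula bounds each member of [C], hence [x]. *)
apply: entails_mp (entails_refl Ax a).
apply: (xC _ _ (yx _ ya)) => z c Cz zc; apply/entails_imp.
apply: (H (idealI y z)); first by exists z.
by split; [apply: ideal_down ya; apply: entails_andr
          |apply: ideal_down zc; apply: entails_andl].
Qed.

Definition ideal_cover_system := CoverSystem ideal_cover_existence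
  ideal_cover_transitivity ideal_cover_refinement.

Lemma ideal_localic : strictly_localic ideal_cover_system.
Proof. by move=> x C [Cx _] y /Cx yx; exists x => //; apply/ideal_leP. Qed.

Definition ideal_rel x y :=
  forall a b, ideal_set x a ->
    (forall c, ideal_set y c -> Circ c |- b) -> a |- b.

Lemma ideal_confluence x y z :
  x <= y -> ideal_rel x z -> exists2 w, ideal_rel y w & z <= w.
Proof. by move=> /ideal_leP yx Rxz; exists z => // a b /yx; apply: Rxz. Qed.

(** The witness is the join of [A], which [A] covers. Each member of [C] is related to an ideal
    contained in this join, so [x], the join of [C], is related to it. *)
Lemma ideal_modal_localisation x (A : set (ideal Ax)) :
    (exists2 C, ideal_cover x C & C `<=` dia ideal_rel A) ->
  exists2 y, ideal_rel x y & exists2 C, ideal_cover y C & C `<=` A.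
Proof.
case=> C [Cx xC] CA.
exists (ideal_closure [set a | exists2 z, A z & ideal_set z a]) => [a b xa H|].
  apply: (xC _ _ xa) => y c /CA[z Az Ryz] yc; apply: (Ryz _ _ yc) => d zd.
  by apply: H; apply: sub_ideal_closure; exists z.
exists A => //; split=> [y Ay a ya|a b ca H].
  by apply: sub_ideal_closure; exists y.
by apply: ca => c [z]; apply: H.
Qed.

Definition canonical : modal_cover_system :=
  @ModalCoverSystem ideal_cover_system ideal_localic ideal_rel
    ideal_confluence ideal_modal_localisation.

Lemma ideal_rel_refl x : ideal_rel x x.
Proof. by move=> a b xa H; apply: entails_trans (entails_circ Ax a) (H a xa). Qed.

(** The meet of [x] and [y] is a witness by the strength axiom: for [a] in [x] and [c] in [y] it
    contains [And a c]. *)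
Lemma ideal_rel_strength x y :
  ideal_rel x y -> exists z, [/\ y <= z, x <= z & ideal_rel x z].
Proof.
move=> Rxy; exists (idealI x y); split; try by apply/ideal_leP => a [].
move=> a b xa H; apply: entails_mp (entails_refl Ax a).
apply: (Rxy _ _ xa) => c yc; apply/entails_swap/entails_imp.
apply: entails_trans (entails_circ_and Ax a c) _; apply: H.
by split; [apply: ideal_down xa; apply: entails_andl
          |apply: ideal_down yc; apply: entails_andr].
Qed.

Lemma canonical_prenuclear : prenuclear canonical.
Proof. split; [exact: ideal_rel_refl|exact: ideal_rel_strength]. Qed.

Lemma canonical_multiplicative :
  axioms_K (Sig := Sig) `<=` Ax -> multiplicative_prenuclear canonical.
Proof.
move=> KAx; split; last exact: ideal_rel_strength.
  by move=> x; exists x; apply: ideal_rel_refl.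
move=> x y z Rxy Rxz; exists (idealI y z); split;
  try by apply/ideal_leP => a [].
move=> a b xa H; apply: entails_mp (entails_refl Ax a).
(* Moving hypotheses to the right gives a bound independent of [c], then one independent of [d], so
   the two relations apply in turn. *)
apply: (Rxz _ _ xa) => c zc; apply: entails_swap.
apply: (Rxy _ _ xa) => d yd; apply/entails_imp.
apply: entails_trans (entails_circ_and2 d c KAx) _; apply: H.
by split; [apply: ideal_down yd; apply: entails_andl
          |apply: ideal_down zc; apply: entails_andr].
Qed.

Lemma ideal_cover0 x : ideal_cover x set0 <-> forall a, ideal_set x a -> a |- Bot.
Proof.
split=> [[_ x0] a xa|x0]; first exact: x0 xa _.
by split=> // a b /x0 aB _; apply: entails_trans aB (entails_bot Ax b).
Qed.

Lemma canonical_iel : axioms_K (Sig := Sig) `<=` Ax -> Ax (Neg (Circ Bot)) ->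
  iel_cover_system canonical.
Proof.
move=> KAx NAx; split; first exact: canonical_multiplicative.
move=> x y Rxy /ideal_cover0 y0; apply/ideal_cover0 => a xa.
apply: (Rxy _ _ xa) => c /y0/der_mono cB; apply: entails_trans cB _.
exact: der_extra.
Qed.

End Canonical_cover_system.

(** * The canonical model *)

Section Canonical_model.
Variables (Sig : signature) (Ax : set (formula Sig)) (k : nat).
Implicit Types (A B : formula Sig) (x y : canonical Ax).
Local Notation "a |- b" := (entails Ax a b) (at level 70).

(** The ideals contained in [principal A], that is, the points above it. *)
Definition below A : set (canonical Ax) :=
  [set x | forall a, ideal_set x a -> a |- A].

Lemma below_proposition A : proposition (below A).
Proof.
split; last by move=> x [C [_ xC] CA] a xa; apply: (xC _ _ xa) => y c /CA; apply.
by apply/seteqP; split=> [y [x xA /ideal_leP yx] a /yx/xA//|x xA]; exists x.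
Qed.

(* The individual [d] is named by the variable [x_(k + d)], so that the name of
   an individual is never captured in a formula whose variables are below [k]. *)
Definition canonical_model : model Sig (canonical Ax) :=
  @Model Sig (canonical Ax) nat (inhabits 0%N)
    (fun P ds => below (Atom (map_tuple (addn k) ds)))
    (fun P ds => below_proposition (Atom (map_tuple (addn k) ds))).

(** If [x] is below the join of the [F i], it is the join of its meets with them; this provides the
    covers for [Or] and [Ex]. *)
Lemma canonical_cover_join (I : Type) (F : I -> formula Sig) x :
    (forall b, (forall i, F i |- b) -> forall a, ideal_set x a -> a |- b) ->
  cover x [set idealI x (principal Ax (F i)) | i in [set: I]].
Proof.
move=> xF; split=> [_ [i _ <-] a []//|a b xa H].
apply: entails_mp (entails_refl Ax a); apply: xF (xa) => i.
apply/entails_imp; apply: (H (idealI x (principal Ax (F i)))); first by exists i.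
by split; [apply: ideal_down xa; apply: entails_andr|apply: entails_andl].
Qed.

(** The truth lemma. An assignment acts as the renaming of each variable to the name of its
    value. *)
Lemma truth_canonical A x (sigma : nat -> nat) : (var_bound A <= k)%N ->
  truth (N := canonical_model) A x sigma <->
  below (rename (fun n => k + sigma n)%N A) x.
Proof.
have upd B y s z d :
    below (rename (fun n => k + [eta s with z |-> d] n)%N B) y <->
    below (rename [eta (fun n => k + s n)%N with z |-> (k + d)%N] B) y.
  rewrite (@eq_rename _ _ [eta (fun n => k + s n)%N with z |-> (k + d)%N]) //.
  by move=> n _ /=; case: eqP.
elim: A x sigma => [P ts||A IA B IB|A IA B IB|A IA B IB|z A IA|z A IA|A IA]
  x s /=; rewrite ?geq_max.
- move=> _; suff -> : map_tuple (addn k) (map_tuple s ts) =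
    map_tuple (fun n => k + s n)%N ts by [].
  by apply: val_inj; rewrite /= -map_comp.
- by move=> _; apply: ideal_cover0.
- case/andP=> /IA tA /IB tB; rewrite tA tB; split=> [[xA xB] a xa|xAB].
    by apply: entails_and; [apply: xA|apply: xB].
  split=> a /xAB; move/entails_trans; apply;
  by [apply: entails_andl|apply: entails_andr].
- case/andP=> /IA tA /IB tB; split=> [[C [Cx xC] CAB] a xa|xAB].
    apply: (xC _ _ xa) => y c Cy yc; case: (CAB y Cy) => [/tA|/tB] /(_ _ yc).
      by move/entails_trans; apply; apply: entails_orl.
    by move/entails_trans; apply; apply: entails_orr.
  set A' := rename _ A in tA xAB; set B' := rename _ B in tB xAB.
  exists [set idealI x (principal Ax (if i then A' else B')) | i in [set: bool]].
    apply: canonical_cover_join => b Hb a /xAB/entails_trans; apply.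
    by apply: entails_or; [apply: (Hb true)|apply: (Hb false)].
  by move=> _ [[] _ <-]; [left; apply/tA => a []|right; apply/tB => a []].
- case/andP=> /IA tA /IB tB; split=> [H a xa|H y /ideal_leP yx /tA yA].
    (* The implication is tested at the meet of [x] with the principal ideal of its antecedent. *)
    apply/entails_imp; set A' := rename _ A.
    have /tB : truth (N := canonical_model) B (idealI x (principal Ax A')) s.
      by apply: H; [apply/ideal_leP => c []|apply/tA => c []].
    apply; split; last exact: entails_andr.
    by apply: ideal_down xa; apply: entails_andl.
  apply/tB => a ya; apply: entails_mp (yA _ ya).
  exact: H (yx _ ya).
- case/andP=> zk Ak; have sk n : (k <= k + s n)%N by apply: leq_addr.
  split=> [H a xa|H d].
    (* A variable [d] from [k] on names the individual [d - k]. *)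
    apply/(entails_all Ax zk Ak sk) => d kd.
    by have /IA/upd := H (d - k)%N; rewrite subnKC //; apply.
  apply/IA => //; apply/upd => a /H/(entails_all Ax zk Ak sk); apply.
  exact: leq_addr.
- case/andP=> zk Ak; have sk n : (k <= k + s n)%N by apply: leq_addr.
  split=> [[C [Cx xC] CA] a xa|H].
    apply: (xC _ _ xa) => y c /CA[d /IA/upd yA] /yA - /(_ Ak) /entails_trans; apply.
    apply: (iffLR (entails_ex Ax zk Ak sk _)); first exact: entails_refl.
    exact: leq_addr.
  pose F d := rename [eta (fun n => k + s n)%N with z |-> (k + d)%N] A.
  exists [set idealI x (principal Ax (F d)) | d in [set: nat]].
    apply: canonical_cover_join => b Hb a /H/entails_trans; apply.
    by apply/(entails_ex Ax zk Ak sk) => d kd; have := Hb (d - k)%N; rewrite /F subnKC.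
  by move=> _ [d _ <-]; exists d; apply/IA => //; apply/upd => a [].
- move=> /IA tA; split=> [[y Rxy /tA yA] a xa|H].
    by apply: (Rxy _ _ xa) => c /yA; apply: der_mono.
  (* The largest ideal forcing the formula under [Circ]. *)
  exists (principal Ax (rename (fun n => k + s n)%N A)); last exact/tA.
  move=> a b /H aA; move/(_ _ (entails_refl Ax _)).
  exact: entails_trans.
Qed.

Lemma canonical_complete A : (var_bound A <= k)%N ->
  true_in_model canonical_model A -> derivable Ax A.
Proof.
(* At the ideal of all formulas, truth under the identity assignment says that every formula, in
   particular a theorem, entails the copy of [A] shifted by [k]. *)
move=> Ak /(_ (ideal_closure Ax setT) id)/truth_canonical-/(_ Ak) TA.
apply: (derivable_rename_add Ak); apply: (@der_mp _ _ (Imp Bot Bot)).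
  by apply: TA; apply: sub_ideal_closure.
exact: entails_refl.
Qed.

End Canonical_model.

(** * Soundness and completeness for the three logics *)

Lemma canonical_cover_system_for (Sig : signature) (L : logic) :
  cover_system_for L (canonical (@extra_axioms Sig L)).
Proof.
case: L => /=; first exact: canonical_prenuclear.
  exact: canonical_multiplicative.
by apply: canonical_iel => [A|]; [left|right].
Qed.

Theorem theorem14 (Sig : signature) (L : logic) (phi : formula Sig) :
  Qprovable L phi <->
  (forall M : modal_cover_system, cover_system_for L M ->
     forall N : model Sig M, true_in_model N phi).
Proof.
split=> [Dphi M LM N|H]; first exact: soundness Dphi LM.
(* Here [k] is [var_bound phi]. *)
exact/(canonical_complete (leqnn _))/H/canonical_cover_system_for.
Qed.
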